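(* Let $d$ be a positive integer and let $G$ be a finite $(X,Y)$-bigraph with maximum degree at most $d$ and girth at least $4ed^2+1$ (where $e$ is Euler's number). Assume that there exists a collection of pairwise vertex-disjoint cycles in $G$ whose union contains every vertex of $X$ (such a collection exists in particular if $G$ is $d$-regular). Then $G$ has a path $X$-cover consisting of at most $\alpha_{\mathsf{\Lambda}}(G)$ paths.
   Context: An $(X,Y)$-bigraph is a bipartite graph together with a specified ordered bipartition $(X,Y)$ of its vertex set. The girth is the length of a shortest cycle. A path $X$-cover of $G$ is a set of pairwise vertex-disjoint paths in $G$ (paths of length $0$ allowed) whose union contains every vertex of $X$. For $S \subseteq X$, let ${\mathsf{\Lambda}}(S)$ denote the set of vertices of $Y$ that have at least two neighbors in $S$. A set $S \subseteq X$ is ${\mathsf{\Lambda}}$-independent if ${\mathsf{\Lambda}}(S) = \varnothing$. The ${\mathsf{\Lambda}}$-independence number $\alpha_{\mathsf{\Lambda}}(G)$ is the maximum size of a ${\mathsf{\Lambda}}$-independent subset of $X$.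
   Formalization: The remark that d-regular graphs have such a cycle collection is proved only for d at least 2: for d = 1 it is false, since a single edge is 1-regular with no cycles (infinite girth), so no cycle covers X. *)

(* Defs.v *)
From HB Require Import structures.
From mathcomp Require Import all_boot all_order all_algebra.
From mathcomp Require Import classical_sets reals ereal sequences.

Set Implicit Arguments.
Unset Strict Implicit.
Unset Printing Implicit Defensive.

(* Loops are excluded by [adj_bip]. Multiple edges cannot be represented; in a
   multigraph they would be cycles of length 2. *)
Record bigraph := Bigraph {
  vertex :> finType;
  adj : rel vertex;
  partX : {set vertex};
  partY : {set vertex};
  adj_sym : symmetric adj;
  partXUY : partX :|: partY = [set: vertex];
  partXIY : partX :&: partY = finset.set0;
  adj_bip : forall u v, adj u v -> (u \in partX) = (v \in partY)
}.

Section Bigraph.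
Variable G : bigraph.

Definition nbr (v : G) : {set G} := [set w | adj v w].

Definition max_degree : nat := \max_(v : G) #|nbr v|.

Definition regular (d : nat) : Prop := forall v : G, #|nbr v| = d.

(* A path is given by its nonempty list of distinct vertices; a one-element
   list is a path of length 0. *)
Definition is_path (p : seq G) : bool :=
  [&& p != [::], sorted (@adj G) p & uniq p].

(* [cycle] holds of the list [:: u; v] whenever u and v are adjacent, hence the
   bound on the size; the length of the graph cycle is then [size c]. *)
Definition is_cycle (c : seq G) : bool :=
  [&& 2 < size c, cycle (@adj G) c & uniq c].

(* The girth of an acyclic graph is +oo. *)
Definition girth (R : realType) : \bar R :=
  ereal_inf [set ((size c)%:R)%:E | c in [set c : seq G | is_cycle c]]%classic.

(* When the members of P are nonempty, P has no repetition, so that it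
   represents a set with [size P] elements. *)
Definition vertex_disjoint (P : seq (seq G)) : bool :=
  pairwise (fun p q : seq G => [disjoint p & q]) P.

Definition covers_X (P : seq (seq G)) : Prop :=
  forall x : G, x \in partX G -> exists2 p, p \in P & x \in p.

Definition path_X_cover (P : seq (seq G)) : Prop :=
  [/\ all is_path P, vertex_disjoint P & covers_X P].

Definition cycle_X_cover (C : seq (seq G)) : Prop :=
  [/\ all is_cycle C, vertex_disjoint C & covers_X C].

Definition Lambda (S : {set G}) : {set G} :=
  [set y in partY G | 2 <= #|nbr y :&: S|].

Definition Lambda_independent (S : {set G}) : bool :=
  (S \subset partX G) && (Lambda S == finset.set0).

Definition alpha_Lambda : nat :=
  \max_(S : {set G} | Lambda_independent S) #|S|.

End Bigraph.

(* Main.v *)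
(** Each of the given cycles, read as a list, is already a path, so these n
    cycles are a path X-cover and only n <= alpha_Lambda remains to be shown.
    As e >= 2, every cycle meets X in at least 4d^2 vertices, while each vertex of X shares
    a neighbor with at most d^2 others. Parts of size at least four times the
    maximum degree of the conflict graph have an independent transversal, here a
    Lambda-independent set with one vertex on each cycle; this follows from a
    counting induction (Rosenfeld; Wanless and Wood) instead of the local lemma.

    If G is d-regular with d >= 2, Hall's theorem gives an injective choice of
    neighbors f0 and then another one f1 that nowhere agrees with the inverse of
    f0. The orbits of the permutation equal to f0 on X and to f1 on Y are cycles
    of G. *)
Require Import Defs.
From mathcomp Require Import all_boot all_order all_algebra.
From mathcomp Require Import classical_sets reals ereal sequences exp.
From mathcomp Require Import fintype finset zify lra.

Set Implicit Arguments.
Unset Strict Implicit.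
Unset Printing Implicit Defensive.

Import Order.TTheory GRing.Theory Num.Theory.

(** * Counting independent transversals of disjoint parts *)

Section Transversal.
Variables (T : finType) (conflict : rel T).

Definition independent (S : {set T}) : bool :=
  [forall x in S, forall y in S, ~~ conflict x y].

(** Confining [S] to [cover I] means that, for disjoint parts, [S] amounts to one choice in each
    part and nothing else; this makes the count meaningful. *)
Definition indep_transversals (I : {set {set T}}) : {set {set T}} :=
  [set S : {set T} | [&& S \subset cover I, [forall B in I, #|S :&: B| == 1]
            & independent S]].

Lemma indep_transversalsP (I : {set {set T}}) (S : {set T}) :
  reflect [/\ S \subset cover I, {in I, forall B, #|S :&: B| = 1}
            & {in S &, forall x y, ~~ conflict x y}]
    (S \in indep_transversals I).
Proof.
rewrite inE; apply: (iffP and3P) => -[-> SI Sc]; split=> //.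
- by move=> B BI; apply/eqP/(forall_inP SI).
- by move=> x y xS yS; have /forall_inP/(_ y yS) := forall_inP Sc x xS.
- by apply/forall_inP => B BI; rewrite SI.
- by apply/forall_inP => x xS; apply/forall_inP => y yS; apply: Sc.
Qed.

(** As the parts are disjoint, [y] lies in no part but [B], and it is the only vertex of [S] in
    [B]. *)
Lemma indep_transversalsD1 (I : {set {set T}}) (B S : {set T}) (y : T) :
  trivIset I -> B \in I -> y \in B -> y \in S ->
  S \in indep_transversals I -> S :\ y \in indep_transversals (I :\ B).
Proof.
move=> tI BI yB yS /indep_transversalsP[sSI SB Sc].
have SBy z : z \in S -> z \in B -> z = y.
  move=> zS zB; have /eqP/cards1P[w Ew] := SB B BI.
  have [] : z \in [set w] /\ y \in [set w] by rewrite -Ew !inE zS zB yS yB.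
  by move=> /set1P-> /set1P->.
apply/indep_transversalsP; split.
- apply/subsetP => z /setD1P[zy zS].
  have /bigcupP[A AI zA] := subsetP sSI z zS.
  apply/bigcupP; exists A => //; rewrite !inE AI andbT.
  by apply: contraNneq zy => AB; rewrite (SBy z) // -AB.
- move=> A /setD1P[AB AI]; rewrite -(SB A AI); apply: eq_card => z.
  rewrite !inE; case: eqVneq => //= ->.
  rewrite yS; apply/esym/negbTE/negP => /= yA.
  by have := trivIsetP tI _ _ AI BI AB; move/disjointFr/(_ yA); rewrite yB.
- by move=> z w /setD1P[_ zS] /setD1P[_ wS]; apply: Sc.
Qed.

Hypothesis conflict_sym : symmetric conflict.
Hypothesis conflict_irr : irreflexive conflict.

Lemma indep_transversalsU1 (I : {set {set T}}) (B S : {set T}) (x : T) :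
  trivIset (B |: I) -> B \notin I -> x \in B ->
  S \in indep_transversals I -> {in S, forall y, ~~ conflict x y} ->
  x |: S \in indep_transversals (B |: I).
Proof.
move=> tI BI xB /indep_transversalsP[sSI SB Sc] xS.
have dis A y : A \in I -> y \in B -> y \in A = false.
  move=> AI yB; apply: (disjointFr _ yB); apply: (trivIsetP tI).
  - exact: setU11.
  - exact: setU1r.
  - by apply: contraNneq BI => ->.
apply/indep_transversalsP; split.
- rewrite /cover bigcup_setU big_set1 subUset sub1set inE xB /=.
  by apply: subset_trans sSI _; apply: subsetUr.
- move=> A /setU1P[->|AI].
    apply/eqP/cards1P; exists x; apply/setP => z; rewrite !inE.
    case: eqVneq => [->//|zx] /=; apply/negP => /andP[zS zB].
    by have /bigcupP[A' A'I zA'] := subsetP sSI z zS; rewrite dis in zA'.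
  rewrite -(SB A AI); apply: eq_card => z; rewrite !inE.
  by case: eqVneq => //= ->; rewrite dis // andbF.
- move=> y z /setU1P[->|yS] /setU1P[->|zS]; rewrite ?conflict_irr ?xS //.
    by rewrite conflict_sym xS.
  exact: Sc.
Qed.

Variable k : nat.
Hypothesis conflict_deg : forall x, 4 * #|[set y | conflict x y]| <= k.

(* Each part multiplies the number of independent transversals by k/2 or more.
   Of the k N(I) ways to extend, a conflict between x in B and y in a part A of
   I spoils at most N(I - A) <= (2/k) N(I), and there are at most k * (k/4)
   such pairs. *)
Lemma indep_transversals_growth (I : {set {set T}}) (B : {set T}) :
  trivIset (B |: I) -> {in B |: I, forall A : {set T}, #|A| = k} ->
  B \notin I ->
  k * #|indep_transversals I| <= 2 * #|indep_transversals (B |: I)|.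
Proof.
have [n] := ubnP #|I|; elim: n => // n IHn in I B * => ltIn tI kI BI.
set N := indep_transversals.
have sII : I \subset B |: I := subsetUr _ _.
(* If [y] lies in a part [A], deleting [y] injects the transversals through [y] into those of
   [I :\ A], which the induction hypothesis compares with those of [I]. If [y] lies in no part,
   there are none. *)
have N_y y : k * #|[set S in N I | y \in S]| <= 2 * #|N I|.
  have [|yI] := boolP (y \in cover I); last first.
    rewrite (_ : [set _ in _ | _] = set0) ?cards0 ?muln0 //.
    apply/setP => S; rewrite in_set0 in_set; apply/negP => /andP[].
    case/indep_transversalsP => /subsetP sS _ _ yS.
    by rewrite sS in yI.
  case/bigcupP => A AI yA.
  have EI : A |: (I :\ A) = I by rewrite setD1K.
  have {IHn} := IHn (I :\ A) A; rewrite EI setD11 => IH.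
  apply: leq_trans (IH _ _ _ _) => //; last 3 first.
  - by rewrite (cardsD1 A I) AI in ltIn.
  - exact: trivIsetS tI.
  - by move=> C CI; apply: kI; apply: setU1r.
  rewrite leq_mul2l; apply/orP; right.
  rewrite -(@card_in_imset _ _ (fun S => S :\ y)); last first.
    move=> S S'; rewrite !inE => /andP[_ yS] /andP[_ yS'] E.
    by rewrite -(setD1K yS) E setD1K.
  apply: subset_leq_card; apply/subsetP => _ /imsetP[S + ->].
  rewrite in_set => /andP[SN yS]; apply: indep_transversalsD1 => //.
  exact: trivIsetS tI.
pose bad := [set p in setX B (N I) | [exists y in p.2, conflict p.1 y]].
have card_pairs : #|setX B (N I)| = k * #|N I|.
  by rewrite cardsX kI // setU11.
have card_bad : 2 * #|bad| <= k * #|N I|.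
  have [k0|k_gt0] := posnP k.
    have : bad \subset setX B (N I) by apply/subsetP => p /setIdP[].
    by move/subset_leq_card; rewrite card_pairs k0 mul0n leqn0 => /eqP->.
  (* Union bound: a bad pair [(x, S)] is counted once for each [y] in [S] in conflict with [x]. *)
  have le_bad : #|bad| <= \sum_(x in B) \sum_(y | conflict x y)
      #|[set S in N I | y \in S]|.
    have -> : \sum_(x in B) \sum_(y | conflict x y) #|[set S in N I | y \in S]|
        = \sum_(p in setX B (N I)) \sum_(y | conflict p.1 y) (y \in p.2).
      under [RHS]eq_bigl do rewrite in_set.
      rewrite -(pair_big _ _ (fun x (S : {set T}) =>
        \sum_(y | conflict x y) (y \in S : nat))).
      apply: eq_bigr => x _ /=; rewrite exchange_big; apply: eq_bigr => y _ /=.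
      by rewrite -sum1_card -big_mkcondr; apply: eq_bigl => S; rewrite inE.
    rewrite -sum1_card [leqLHS]big_mkcond [leqRHS]big_mkcond; apply: leq_sum => p _.
    rewrite in_set; case: (_ \in _) => //=.
    by case: existsP => // -[y /andP[yp cy]]; rewrite (bigD1 y) //= yp.
  (* After multiplication by [k], [N_y] applies to each of the at most [k / 4] terms of a given [x],
     whose sum is then at most half of [k * #|N I|]. *)
  rewrite -(leq_pmul2l k_gt0) mulnCA.
  apply: leq_trans (_ : \sum_(x in B) k * #|N I| <= _); last first.
    by rewrite sum_nat_const kI ?setU11.
  apply: leq_trans (leq_mul (leqnn 2) (leq_mul (leqnn k) le_bad)) _.
  rewrite !big_distrr /=; apply: leq_sum => x _.
  apply: leq_trans (_ : 4 * #|[set y | conflict x y]| * #|N I| <= _); last first.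
    by rewrite leq_mul2r conflict_deg orbT.
  rewrite -mulnA mulnCA -sum_nat_cond_const mulnA !big_distrr /=.
  apply: leq_sum => y _.
  by rewrite mulnAC [k * _ * 2]mulnC -[4]/(2 * 2) -mulnA leq_mul2l N_y.
(* [S] misses [B], so [x] is the only vertex of [x |: S] in [B], and the pair can be recovered from
   the union. *)
have card_good : #|setX B (N I) :\: bad| <= #|N (B |: I)|.
  have notin x S : x \in B -> S \in N I -> x \notin S.
    move=> xB /indep_transversalsP[/subsetP sS _ _]; apply/negP => /sS.
    case/bigcupP => A AI xA; have AB : A != B by apply: contraNneq BI => <-.
    have := trivIsetP tI A B (setU1r _ AI) (setU11 _ _) AB.
    by move/disjointFr/(_ xA); rewrite xB.
  rewrite -(@card_in_imset _ _ (fun p : T * {set T} => p.1 |: p.2)).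
    apply/subset_leq_card/subsetP => _ /imsetP[[x S] + ->] /=.
    rewrite in_setD [_ \in bad]in_set => /andP[+ xS].
    rewrite xS /= => /exists_inPn cS; move: xS; rewrite in_setX => /andP[xB SN].
    exact: indep_transversalsU1.
  move=> [x S] [x' S'] /setDP[+ _] /setDP[+ _].
  rewrite !in_setX /= => /andP[xB SN] /andP[xB' SN'] E.
  have xx' : x = x'.
    have : x \in x' |: S' by rewrite -E setU11.
    by case/setU1P => // xS'; have := notin x S' xB SN'; rewrite xS'.
  by subst x'; rewrite -(setU1K (notin x S xB SN)) E setU1K ?notin.
move: card_good; rewrite cardsD (setIidPr _) ?card_pairs; last first.
  by apply/subsetP => p /setIdP[].
lia.
Qed.

(** The empty family has the transversal [set0], and by the growth bound with [k > 0] each further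
    part keeps the count positive. *)
Lemma indep_transversal_exists (P : {set {set T}}) :
  0 < k -> trivIset P -> {in P, forall A : {set T}, #|A| = k} ->
  exists2 S, S \in indep_transversals P & #|S| = #|P|.
Proof.
move=> k_gt0 tP kP.
suff : 0 < #|indep_transversals P|.
  case/card_gt0P => S SP; exists S => //; apply: (@card_transversal _ _ _ (cover P)).
  have /indep_transversalsP[sS SB _] := SP.
  apply/and3P; split=> //; last by apply/forall_inP => B BP; rewrite SB.
  apply/and3P; split=> //; apply/negP => P0.
  by have := kP _ P0; rewrite cards0 => k0; rewrite -k0 in k_gt0.
have [n] := ubnP #|P|; elim: n => // n IHn in P tP kP *.
have [->|[B BP] ltPn] := set_0Vmem P.
  move=> _; apply/card_gt0P; exists set0; apply/indep_transversalsP.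
  by split=> [|B|x y]; rewrite ?sub0set ?inE.
have EP := setD1K BP; rewrite -EP in tP kP *.
have := indep_transversals_growth tP kP; rewrite setD11 => /(_ isT).
have : 0 < #|indep_transversals (P :\ B)|.
  apply: IHn.
  - exact: trivIsetS (subsetUr _ _) tP.
  - by move=> A AP; apply: kP; apply: setU1r.
  - by rewrite (cardsD1 B P) BP in ltPn.
move=> /(conj k_gt0)/andP; rewrite -muln_gt0 => /leq_trans h /h.
by rewrite muln_gt0.
Qed.
End Transversal.

(** * Hall's marriage theorem *)

Section Hall.
Variables T U : finType.

Definition nbhd (r : T -> {set U}) (S : {set T}) : {set U} := \bigcup_(x in S) r x.

(** Induction on the total size of the sets [r x]: while one of them has two elements, an element
    can be deleted from it. Once all are singletons, the condition on pairs makes the forced choice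
    injective. *)
Lemma hall (r : T -> {set U}) :
  (forall S : {set T}, #|S| <= #|nbhd r S|) ->
  exists2 f : T -> U, injective f & forall x, f x \in r x.
Proof.
have [n] := ubnP (\sum_x #|r x|); elim: n => // n IHn in r * => ltn hallr.
have [r1|] := boolP [forall x, #|r x| == 1].
  have rP x : {y | r x = [set y]}.
    by apply: sig_eqW; apply/cards1P; apply: (forallP r1).
  have [f fE] : {f : T -> U | forall x, r x = [set f x]}.
    by exists (fun x => sval (rP x)) => x; case: (rP x).
  exists f => [x x' E|x]; last by rewrite fE set11.
  apply/eqP/negPn/negP => xx'; have := hallr [set x; x'].
  by rewrite cards2 xx' /nbhd bigcup_setU !big_set1 !fE E setUid cards1.
rewrite negb_forall => /existsP[x rx].
have rx_gt1 : 1 < #|r x|.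
  have := hallr [set x]; rewrite /nbhd big_set1 cards1.
  by case: #|r x| rx => [|[]].
have [y1 [y2 [y1x y2x y12]]] := card_gt1P rx_gt1.
pose del y z := if z == x then r z :\ y else r z.
have del_sub y z : del y z \subset r z by rewrite /del; case: ifP; rewrite ?subD1set.
have del_neq y z : z != x -> del y z = r z by rewrite /del => /negPf->.
(* Rado's argument: if neither y1 nor y2 can be deleted from r x, two sets S1
   and S2 violate the condition, and submodularity of #|nbhd _| gives a violation
   for r itself. *)
have [y yx hally] : exists2 y, y \in r x &
    forall S : {set T}, #|S| <= #|nbhd (del y) S|.
  have [h|] := boolP [forall S : {set T}, #|S| <= #|nbhd (del y1) S|].
    by exists y1 => //; apply/forallP.
  rewrite negb_forall => /existsP[S1]; rewrite -ltnNge => bad1.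
  have [h|] := boolP [forall S : {set T}, #|S| <= #|nbhd (del y2) S|].
    by exists y2 => //; apply/forallP.
  rewrite negb_forall => /existsP[S2]; rewrite -ltnNge => bad2.
  have inS y (S : {set T}) : #|nbhd (del y) S| < #|S| -> x \in S.
    apply: contraTT => xS; rewrite -leqNgt; apply: leq_trans (hallr S) _.
    apply/subset_leq_card/bigcupsP => z zS; apply: (bigcup_max z) => //.
    by rewrite del_neq //; apply: contraNneq xS => <-.
  have x1 := inS _ _ bad1; have x2 := inS _ _ bad2.
  (* Since [y1 != y2], [r x] is the union of [del y1 x] and [del y2 x]. *)
  have leU : #|S1 :|: S2| <= #|nbhd (del y1) S1 :|: nbhd (del y2) S2|.
    apply: leq_trans (hallr _) _; apply/subset_leq_card/bigcupsP => z.
    have [->|zx] := eqVneq z x => zS.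
      apply/subsetP => y yx; have [->|yy1] := eqVneq y y1; apply/setUP.
        by right; apply/bigcupP; exists x; rewrite // /del eqxx !inE y12.
      by left; apply/bigcupP; exists x; rewrite // /del eqxx !inE yy1.
    case/setUP: zS => zS; apply: subsetU; apply/orP; [left|right];
      by apply: (bigcup_max z) => //; rewrite del_neq.
  (* The vertex [x] is left out because [y1] and [y2] may be missing from the intersection. *)
  have leI : #|(S1 :&: S2) :\ x| <= #|nbhd (del y1) S1 :&: nbhd (del y2) S2|.
    apply: leq_trans (hallr _) _; apply/subset_leq_card/bigcupsP => z.
    case/setD1P => zx /setIP[zS1 zS2]; rewrite subsetI.
    by apply/andP; split; apply: (bigcup_max z); rewrite ?del_neq.
  (* Adding [leU] and [leI] bounds [#|S1| + #|S2| - 1] by the sum of the two neighborhood sizes,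
     which is at most [#|S1| + #|S2| - 2]. *)
  have := cardsD1 x (S1 :&: S2); rewrite inE x1 x2 /=.
  have := cardsUI S1 S2; have := cardsUI (nbhd (del y1) S1) (nbhd (del y2) S2).
  lia.
have [|f f_inj fr] := IHn (del y) _ hally.
  apply: (@leq_trans (\sum_z #|r z|)) => //.
  rewrite (bigD1 x) //= [leqRHS](bigD1 x) //=.
  rewrite {1}/del eqxx (cardsD1 y (r x)) yx ltnS leq_add2l.
  by apply: leq_sum => z _; apply: subset_leq_card.
by exists f => // z; apply: (subsetP (del_sub y z)).
Qed.

(** Double counting of the pairs of [x] in [S] and [y] in [r x]: there are at least [k * #|S|] and
    at most [k * #|nbhd r S|]. *)
Lemma hall_regular (r : T -> {set U}) (k : nat) :
  0 < k -> (forall x, k <= #|r x|) -> (forall y, #|[set x | y \in r x]| <= k) ->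
  exists2 f : T -> U, injective f & forall x, f x \in r x.
Proof.
move=> k_gt0 rk kr; apply: hall => S; rewrite -(leq_pmul2r k_gt0).
apply: leq_trans (_ : \sum_(x in S) #|r x| <= _).
  by rewrite -sum_nat_const; apply: leq_sum.
rewrite -sum_nat_const.
under eq_bigr do rewrite -sum1_card.
rewrite (exchange_big_dep (mem (nbhd r S))) /=; last first.
  by move=> x y xS yx; apply/bigcupP; exists x.
apply: leq_sum => y _; apply: leq_trans (kr y); rewrite sum1dep_card.
by apply/subset_leq_card/subsetP => x; rewrite !inE => /andP[].
Qed.
End Hall.

Lemma pairwise_in_sym (T : eqType) (r : rel T) (s : seq T) :
  symmetric r -> pairwise r s -> {in s &, forall x y, x != y -> r x y}.
Proof.
move=> r_sym; elim: s => // z s IHs /= /andP[/allP zs /IHs{}IHs] x y.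
rewrite !inE => /predU1P[->|xs] /predU1P[->|ys] //; first by rewrite eqxx.
- by move=> _; apply: zs.
- by move=> _; rewrite r_sym zs.
- exact: IHs.
Qed.

(** * Cycle covers: existence in regular bigraphs, and their size against [alpha_Lambda] *)

Section Cycles.
Variable G : bigraph.
Implicit Types (u v x y : G) (p c : seq G).

Lemma partYE v : (v \in partY G) = (v \notin partX G).
Proof.
have := partXUY G => /setP/(_ v); have := partXIY G => /setP/(_ v).
by rewrite !inE; case: (v \in _); case: (v \in _).
Qed.

Lemma adj_partX u v : adj u v -> (v \in partX G) = (u \notin partX G).
Proof. by move/adj_bip; rewrite partYE => ->; rewrite negbK. Qed.

Lemma mem_nbr u v : (v \in nbr u) = adj u v.
Proof. by rewrite inE. Qed.

Lemma regular_cycle_X_cover (d : nat) :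
  1 < d -> regular G d -> exists C : seq (seq G), cycle_X_cover C.
Proof.
move=> d_gt1 Gd.
have cardN v : #|[set u | v \in nbr u]| = #|nbr v|.
  by apply: eq_card => u; rewrite !inE adj_sym.
have [|v|v|f0 f0_inj f0_nbr] := @hall_regular _ _ (@nbr G) d.
- exact: ltnW.
- by rewrite Gd.
- by rewrite cardN Gd.
pose g := finv f0.
have [|v|v|f1 f1_inj f1_nbr] := @hall_regular _ _ (fun v => nbr v :\ g v) d.-1.
- by case: d d_gt1 {Gd} => [|[]].
- by rewrite -(Gd v) (cardsD1 (g v)); case: (_ \in _) => //; apply: leq_pred.
(* [g u = v] holds only for [u = f0 v], so [v] stops being a choice for just one of its [d]
   neighbors. *)
- have -> : d.-1 = #|nbr v :\ f0 v|.
    by rewrite -(Gd v) (cardsD1 (f0 v) (nbr v)) f0_nbr.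
  apply/subset_leq_card/subsetP => u; rewrite !inE => /andP[vgu uv].
  by rewrite adj_sym uv andbT; apply: contraNneq vgu => ->; rewrite /g finv_f.
pose f v := if v \in partX G then f0 v else f1 v.
have f_adj v : adj v (f v).
  rewrite /f; case: ifP => _; first by rewrite -mem_nbr.
  by have := f1_nbr v; rewrite !inE => /andP[].
have f_inj : injective f.
  move=> u v E; have : (u \in partX G) = (v \in partX G).
    by apply: negb_inj; rewrite -!(adj_partX (f_adj _)) E.
  move: E; rewrite /f => + uv; rewrite uv.
  by case: ifP => _; [exact: f0_inj|exact: f1_inj].
have f1_neq v : f1 v != g v by have := f1_nbr v; rewrite !inE => /andP[].
(* This excludes orbits of length 2; length 1 is excluded because an edge changes sides. *)
have ff_neq v : f (f v) != v.
  rewrite [f (f v)]/f (adj_partX (f_adj v)) /f; case: (v \in partX G) => /=.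
    by have := f1_neq (f0 v); rewrite /g finv_f.
  by apply: contraNneq (f1_neq v) => E; rewrite -{2}E /g finv_f.
exists [seq orbit f x | x in froots f]; split.
- apply/allP => _ /imageP[x _ ->]; apply/and3P; split=> //.
    rewrite size_orbit ltnNge; apply/negP.
    have := iter_order f_inj x; have := order_gt0 f x.
    case: (order f x) => [|[|[|]]] //= _ E _.
      by have := f_adj x; rewrite E => /adj_partX; case: (x \in _).
    by have := ff_neq x; rewrite E eqxx.
  apply: sub_cycle (cycle_orbit f_inj x) => u v /= /eqP <-; exact: f_adj.
- have fC := fconnect_sym f_inj.
  rewrite /vertex_disjoint pairwise_map.
  have := enum_uniq (froots f); rewrite uniq_pairwise.
  apply: sub_in_pairwise (allss (enum (froots f))) => x y.
  rewrite !mem_enum => xr yr /= xy; apply/pred0Pn => -[z /andP[/=]].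
  rewrite -!fconnect_orbit => xz yz; case/negP: xy; rewrite -(eqP xr) -(eqP yr).
  by rewrite root_connect //; apply: connect_trans xz _; rewrite fC.
- move=> x _; exists (orbit f (froot f x)).
    by apply/image_f/roots_root/fconnect_sym.
  by rewrite -fconnect_orbit fconnect_sym // connect_root.
Qed.

(** Vertices alternate between the sides, so only a path starting outside X can have one more vertex
    outside X than inside. *)
Lemma size_path_le x p :
  path (@adj G) x p ->
  size (x :: p) <= 2 * count [in partX G] (x :: p) + (x \notin partX G).
Proof.
elim: p x => [|y p IHp] x /=; first by case: (x \in _).
case/andP => /adj_partX xy /IHp; rewrite /= {}xy.
by case: (x \in _) => /=; lia.
Qed.

Lemma size_cycle_le c : is_cycle c -> size c <= 2 * count [in partX G] c + 1.
Proof.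
case: c => [|x p]; first by [].
case/and3P => _ /=; rewrite rcons_path => /andP[/size_path_le xp _] _.
by apply: leq_trans xp _; rewrite leq_add2l leq_b1.
Qed.

Lemma is_cycle_path c : is_cycle c -> is_path c.
Proof.
case: c => [|x p]; first by [].
by case/and3P => _ /=; rewrite rcons_path => /andP[xp _] Uc; apply/and3P.
Qed.

(** The conflict relation for the transversals; [x != x'] makes it irreflexive. *)
Definition common_nbr : rel G :=
  [rel x x' | (x != x') && [exists y, adj x y && adj x' y]].

Lemma card_common_nbr d x :
  max_degree G <= d -> #|[set x' | common_nbr x x']| <= d ^ 2.
Proof.
move=> degd; have nbrd v : #|nbr v| <= d.
  by apply: leq_trans degd; apply: (leq_bigmax v).
apply: leq_trans (_ : #|\bigcup_(y in nbr x) nbr y| <= _).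
  apply/subset_leq_card/subsetP => x'; rewrite inE.
  case/andP => _ /existsP[y /andP[xy x'y]].
  by apply/bigcupP; exists y; rewrite inE // adj_sym.
apply: leq_trans (_ : \sum_(y in nbr x) #|nbr y| <= _).
  elim/big_rec2: _ => [|y n A _ le_An]; first by rewrite cards0.
  by apply: leq_trans (leq_card_setU _ _) _; rewrite leq_add2l.
apply: leq_trans (_ : \sum_(y in nbr x) d <= _); first exact: leq_sum.
by rewrite sum_nat_const expnS expn1 leq_mul2r nbrd orbT.
Qed.

Lemma Lambda_independent_common_nbr (S : {set G}) :
  S \subset partX G -> {in S &, forall x x', ~~ common_nbr x x'} ->
  Lambda_independent S.
Proof.
move=> sSX Sc; rewrite /Lambda_independent sSX /=; apply/eqP/setP => y.
rewrite in_set0 in_set; apply/negP => /andP[_ /card_gt1P[x [x' []]]].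
rewrite !inE => /andP[yx xS] /andP[yx' x'S] xx'.
case/negP: (Sc x x' xS x'S); rewrite /common_nbr /= xx'.
by apply/existsP; exists y; rewrite !(adj_sym _ y) yx.
Qed.

Lemma cycle_X_cover_le_alpha d (C : seq (seq G)) :
  0 < d -> max_degree G <= d -> cycle_X_cover C ->
  {in C, forall c : seq G, 8 * d ^ 2 < size c} -> size C <= alpha_Lambda G.
Proof.
move=> d_gt0 degd [/allP cycC disC _] sizeC.
pose k := 4 * d ^ 2.
have k_gt0 : 0 < k by rewrite muln_gt0 expn_gt0 d_gt0.
(* Each cycle is cut down to exactly [k] vertices of X, since the counting argument takes parts of
   equal size. *)
pose V c := [set x in take k [seq x <- c | x \in partX G]].
have V_sub c x : x \in V c -> (x \in partX G) && (x \in c).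
  by rewrite inE => /mem_take; rewrite mem_filter.
have V_card c : c \in C -> #|V c| = k.
  move=> cC; have /and3P[_ _ Uc] := cycC c cC.
  rewrite cardsE (card_uniqP _) ?take_uniq ?filter_uniq //.
  rewrite size_takel // size_filter.
  (* From [8 * d ^ 2 + 1 <= size c <= 2 * count + 1], the cycle has at least [k] vertices in X. *)
  by have := size_cycle_le (cycC c cC); have := sizeC c cC; rewrite /k; lia.
(* Distinctness of the parts makes the set [P] have as many members as the list [C]. *)
have V_neq c c' : c \in C -> c' \in C -> [disjoint c & c'] -> V c != V c'.
  move=> cC c'C dis; apply/eqP => E; have : 0 < #|V c| by rewrite V_card.
  case/card_gt0P => x xV; have /andP[_ xc] := V_sub c x xV.
  by move: xV; rewrite E => /V_sub/andP[_]; rewrite (disjointFr dis xc).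
pose P := [set A in [seq V c | c <- C]].
have cardP : #|P| = size C.
  rewrite cardsE (card_uniqP _) ?size_map // uniq_pairwise pairwise_map.
  by apply: sub_in_pairwise (allss C) disC => c c' cC c'C; apply: V_neq.
have tP : trivIset P.
  apply/trivIsetP => A B; rewrite !inE => /mapP[c cC ->] /mapP[c' c'C ->] VV.
  have cc' : c != c' by apply: contraNneq VV => ->.
  have dis : [disjoint c & c'].
    apply: pairwise_in_sym disC _ _ cC c'C cc' => p q; exact: disjoint_sym.
  apply/pred0Pn => -[x /andP[/V_sub/andP[_ xc] /V_sub/andP[_]]].
  by rewrite (disjointFr dis xc).
have kP : {in P, forall A : {set G}, #|A| = k}.
  by move=> A; rewrite inE => /mapP[c cC ->]; apply: V_card.
have confl_irr : irreflexive common_nbr.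
  by move=> x; rewrite /common_nbr /= eqxx.
have confl_sym : symmetric common_nbr.
  move=> x x'; rewrite /common_nbr /= eq_sym; congr (_ && _).
  by apply: eq_existsb => y; rewrite andbC.
have confl_deg x : 4 * #|[set y | common_nbr x y]| <= k.
  by rewrite leq_mul2l card_common_nbr.
have [S /indep_transversalsP[/subsetP sS _ Sc] cardS] :=
  indep_transversal_exists confl_sym confl_irr confl_deg k_gt0 tP kP.
rewrite -cardP -cardS.
apply: (@leq_bigmax_cond _ _ (fun S : {set G} => #|S|)).
apply: Lambda_independent_common_nbr => //; apply/subsetP => x /sS.
by case/bigcupP => A; rewrite inE => /mapP[c _ ->] /V_sub/andP[].
Qed.
End Cycles.

(** * From the girth bound to cycle lengths, and the conclusion *)

Lemma size_cycle_girth (R : realType) (d : nat) (G : bigraph) (c : seq G) :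
  ((4 * expR 1 * d%:R ^+ 2 + 1)%R%:E <= girth G R)%E ->
  is_cycle c -> 8 * d ^ 2 < size c.
Proof.
move=> girth_ge cyc; rewrite -(ltr_nat R).
have size_ge : ((4 * expR 1 * d%:R ^+ 2 + 1)%R <= (size c)%:R :> R)%R.
  rewrite -lee_fin; apply: le_trans girth_ge _.
  by apply: ereal_inf_lbound; exists c.
apply: lt_le_trans size_ge.
(* This is [1 + x <= expR x] at [x = 1]. *)
have e_ge2 : (2 <= expR 1 :> R)%R by have := expR_ge1Dx (1 : R)%R.
rewrite natrM natrX ltr_pwDr // ler_wpM2r ?exprn_ge0 //.
by have := e_ge2; lra.
Qed.

Theorem theorem6 (R : realType) (d : nat) (G : bigraph)
    (d_gt0 : 0 < d)
    (deg_le : max_degree G <= d)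
    (girth_ge : ((4 * expR 1 * d%:R ^+ 2 + 1)%R%:E <= girth G R)%E) :
  ((exists C : seq (seq G), cycle_X_cover C) ->
     exists P : seq (seq G), path_X_cover P /\ size P <= alpha_Lambda G)
  /\ (1 < d -> regular G d -> exists C : seq (seq G), cycle_X_cover C).
Proof.
split=> [[C coverC]|]; last exact: regular_cycle_X_cover.
have [/allP cycC disC XC] := coverC.
exists C; split.
  by split=> //; apply/allP => c /cycC; apply: is_cycle_path.
apply: cycle_X_cover_le_alpha d_gt0 deg_le coverC _ => c /cycC.
exact: size_cycle_girth girth_ge.
Qed.
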